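(* There is a deterministic distributed algorithm in the LOCAL model that finds a maximal half-integral matching in every graph of maximum degree at most $3$ in $O(1)$ rounds (i.e. the number of rounds is bounded by a constant independent of the input graph).
   Context: Fractional matching: for a finite simple graph $G=(V,E)$ and $x\colon E\to[0,1]$, write $x[v]=\sum_{e\in E: v\in e} x(e)$ for $v \in V$. The function $x$ is a fractional matching if $x[v]\le 1$ for all $v\in V$; it is a maximal fractional matching if in addition for every edge $\{u,v\}\in E$ at least one endpoint is saturated, i.e. $x[u]=1$ or $x[v]=1$. A maximal half-integral matching is a maximal fractional matching $x$ with $x(e)\in\{0,\frac12,1\}$ for every $e\in E$. PN (port-numbering) model: each node of the input graph $G$ is a computer and each edge is a communication link. An adversary chooses a port numbering: each node $v$ of degree $\deg(v)$ refers to its incident edges by the numbers $1,\dotsc,\deg(v)$. Initially each node knows only its degree (and the global maximum degree bound), and nodes of the same degree start in the same state. Computation is deterministic and proceeds in synchronous rounds; in each round each node sends a message (of arbitrary size) through each port, receives a message from each port, and updates its state by arbitrary local computation as a function of its current state and the received messages. A node may stop after any number of rounds and announce its local output, here the value $x(e)$ of each incident edge $e$ (the two endpoints of an edge must announce the same value). The running time is the number of rounds until all nodes have stopped. An algorithm must be correct for every input graph in the family and every port numbering. LOCAL model: the same as the PN model, except that each node is additionally given as input a unique identifier, chosen by an adversary from a set of size polynomial in $n=|V|$, e.g. $\{1,\dotsc,n^c\}$ for a fixed constant $c \ge 1$. An algorithm must be correct for every choice of unique identifiers. *)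

(* Defs.v *)
From mathcomp Require Import all_boot all_order all_algebra.

Set Implicit Arguments.
Unset Strict Implicit.
Unset Printing Implicit Defensive.

Import Order.TTheory GRing.Theory Num.Theory.

Record sgraph := SGraph {
  vertex :> finType;
  adj : rel vertex;
  adj_sym : symmetric adj;
  adj_irrefl : irreflexive adj
}.

Definition deg (G : sgraph) (v : G) : nat := #|[set u | adj v u]|.

Definition max_deg_le (G : sgraph) (Delta : nat) : Prop :=
  forall v : G, deg v <= Delta.

Definition edges (G : sgraph) : {set {set G}} :=
  [set [set p.1; p.2] | p : G * G & adj p.1 p.2].

(* A labelling of the edges is a function on all vertex sets of which only the
   values on [edges G] matter. *)
Section Matching.
Local Open Scope ring_scope.
Variables (G : sgraph) (x : {set G} -> rat).

Definition load (v : G) : rat := \sum_(e in edges G | v \in e) x e.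

Definition fractional_matching : Prop :=
  (forall e, e \in edges G -> 0 <= x e <= 1) /\ (forall v, load v <= 1).

Definition maximal_fractional_matching : Prop :=
  fractional_matching /\
  (forall u v : G, adj u v -> load u = 1 \/ load v = 1).

Definition maximal_half_integral_matching : Prop :=
  maximal_fractional_matching /\
  (forall e, e \in edges G -> [\/ x e = 0, x e = 1 / 2 | x e = 1]).

End Matching.

(* Ports are numbered from 0: [port v i] is the neighbour of [v] at the other
   end of its [i]-th incident edge. *)
Record port_numbering (G : sgraph) := PortNumbering {
  port : forall v : G, 'I_(deg v) -> G;
  port_inj : forall v, injective (port (v := v));
  port_codom : forall v u, (u \in codom (port (v := v))) = adj v u
}.

Lemma back_port_subproof (G : sgraph) (p : port_numbering G) (v : G)
    (i : 'I_(deg v)) : exists j : 'I_(deg (port p i)), port p j == v.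
Proof.
have: v \in codom (port p (v := port p i)).
  by rewrite port_codom adj_sym -(port_codom p) codom_f.
by case/codomP=> j jE; exists j; rewrite -jE.
Qed.

(* The port under which the neighbour [port p i] refers to the edge that [v]
   refers to by [i]. *)
Definition back_port (G : sgraph) (p : port_numbering G) (v : G)
    (i : 'I_(deg v)) : 'I_(deg (port p i)) :=
  xchoose (back_port_subproof p i).

(* [I] is the type of local inputs and [O] that of the values announced on the
   incident edges.  The functions of a node may depend on its degree [d];
   [init Delta d a] is the initial state of a node of degree [d] with local
   input [a] when the maximum degree is known to be at most [Delta].  A node
   has stopped when [output] is not [None]. *)
Record algorithm (I O : Type) := Algorithm {
  state : Type;
  message : Type;
  init : forall Delta d : nat, I -> state;
  send : forall d : nat, state -> 'I_d -> message;
  receive : forall d : nat, state -> {ffun 'I_d -> message} -> state;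
  output : forall d : nat, state -> option {ffun 'I_d -> O}
}.

Section Execution.
Variables (I O : Type) (A : algorithm I O).
Variables (Delta : nat) (G : sgraph) (p : port_numbering G) (input : G -> I).

(* The state of a stopped node no longer changes; the messages it sends are
   those determined by its final state. *)
Definition step (s : G -> state A) (v : G) : state A :=
  if output (deg v) (s v) is Some _ then s v
  else receive (s v) [ffun i : 'I_(deg v) =>
         send (s (port p i)) (back_port p i)].

Definition run (t : nat) : G -> state A :=
  iter t step (fun v => init A Delta (deg v) (input v)).

Definition outputs_within (T : nat) (x : {set G} -> O) : Prop :=
  forall v : G, exists2 y : {ffun 'I_(deg v) -> O},
    output (deg v) (run T v) = Some y &
    forall i, y i = x [set v; port p i].

End Execution.

Definition LOCAL_algorithm (O : Type) := algorithm nat O.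

Definition unique_ids (c : nat) (G : sgraph) (id : G -> nat) : Prop :=
  injective id /\ (forall v, 1 <= id v <= #|G| ^ c).

(* Main.v *)
Require Import Defs.
From mathcomp Require Import all_boot all_order all_algebra.
From mathcomp Require Import zify.

(** Give every node an out-copy and an in-copy and every edge [uv] the two links
[out u -- in v] and [out v -- in u]; on this 2-coloured graph a greedy maximal
matching takes three rounds of proposals, and each matched link puts 1/2 on its
edge.  Two adjacent unsaturated nodes then both have load 1/2 (they are
[half]), and as one edge of a half node is used up, the graph of half nodes has
maximum degree 2.

Put 1/2 on each edge between half nodes (and 1 on such an edge if it forms a
component of its own).  Nodes already saturated by these edges drop their
matched link, after which the matching is extended to a maximal one on the free
copies.  If two adjacent nodes are still unsaturated, one of them has lost a
link to a node that dropped it; a node that has lost a link has at most one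
unsaturated neighbour, because a second one of its three edges goes to the node
that dropped the link and a third one carries its remaining load.  Hence the
graph of unsaturated nodes consists of stars, and one round in which each node
picks an unsaturated neighbour and mutual picks receive 1/2 completes the
matching. *)

Set Implicit Arguments.
Unset Strict Implicit.
Unset Printing Implicit Defensive.

(** * Views and functions computable in constantly many rounds *)

Record network := Network {
  graph :> sgraph;
  nb : graph -> seq graph;
  ident : graph -> nat;
  nb_uniq : forall v, uniq (nb v);
  mem_nb : forall v u, (u \in nb v) = adj v u;
  size_nb : forall v, size (nb v) <= 3;
  ident_inj : injective ident
}.

Inductive tree := Node of nat & seq tree.

Definition root t := let: Node a _ := t in a.
Definition children t := let: Node _ s := t in s.

Fixpoint trunc n t :=
  Node (root t) (if n is m.+1 then [seq trunc m c | c <- children t] else [::]).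

(** The tree of walks of length [T] from [v], backtracking included: all that [v] can learn in [T]
    rounds. *)
Fixpoint view (N : network) T (v : N) : tree :=
  Node (ident v) (if T is T'.+1 then [seq view T' u | u <- nb v] else [::]).

Lemma trunc_view (N : network) T k (v : N) : trunc T (view (T + k) v) = view T v.
Proof.
elim: T v => [|T IH] v /=; first by case: k.
by rewrite -map_comp; congr Node; apply: eq_map => u; apply: IH.
Qed.

(** Both [T] and [F] are fixed before the network, so this is constant-time computability. The
    closure lemmas below replace a description of the messages of each phase. *)
Definition local X (f : forall N : network, N -> X) :=
  exists T (F : tree -> X), forall (N : network) (v : N), f N v = F (view T v).

Lemma eq_local X (f g : forall N : network, N -> X) :
  (forall (N : network) (v : N), f N v = g N v) -> local f -> local g.
Proof. by move=> fg [T [F fE]]; exists T, F => N v; rewrite -fg. Qed.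

Lemma local_const X (c : X) : local (fun N v => c).
Proof. by exists 0, (fun=> c). Qed.

Lemma local_ident : local ident.
Proof. by exists 0, root. Qed.

Lemma local_app2 X Y Z (F : X -> Y -> Z) f g :
  local f -> local g -> local (fun N v => F (f N v) (g N v)).
Proof.
move=> [T [Ff fE]] [T' [Fg gE]].
exists (T + T'), (fun t => F (Ff (trunc T t)) (Fg (trunc T' t))) => N v.
by rewrite fE gE trunc_view addnC trunc_view.
Qed.

Lemma local_nb X (f : forall N : network, N -> X) :
  local f -> local (fun N v => [seq f N u | u <- nb v]).
Proof.
move=> [T [F fE]]; exists T.+1, (fun t => map F (children t)) => N v /=.
by rewrite -map_comp; apply: eq_map => u; apply: fE.
Qed.

Lemma local_nb2 X Y Z (F : X -> seq Y -> Z) f g :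
  local f -> local g -> local (fun N v => F (f N v) [seq g N u | u <- nb v]).
Proof. by move=> lf lg; apply: local_app2 => //; apply: local_nb. Qed.

(** * The algorithm that gathers views *)

Section FullInformation.
Variables (O : Type) (o0 : O) (T : nat) (F : tree -> seq O).

Definition full_information : LOCAL_algorithm O :=
  @Algorithm nat O (nat * tree) tree
    (fun _ _ a => (0, Node a [::]))
    (fun _ s _ => s.2)
    (fun _ s m => (s.1.+1, Node (root s.2) (codom m)))
    (fun _ s => if s.1 == T then Some [ffun i => nth o0 (F s.2) (val i)] else None).

(** Nodes send their whole views, so the trees received through the ports are the children of the
    next view. The counter stays below [T] until the last round, so no node stops early. *)
Lemma run_full_information Delta (N : network) (p : port_numbering N) t (v : N) :
  (forall v : N, nb v = codom (port p (v := v))) ->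
  t <= T -> run full_information Delta p (@ident N) t v = (t, view t v).
Proof.
move=> nbE; elim: t v => [//|t IH] v ltT.
have runS : run full_information Delta p (@ident N) t.+1 v =
  step p (run full_information Delta p (@ident N) t) v by [].
rewrite {}runS; move: (run _ _ _ _ t) IH => s IH.
have {}IH u : s u = (t, view t u) by apply/IH/ltnW.
rewrite /step IH /= ltn_eqF //; congr (_, Node _ _); first by case: t {IH ltT}.
rewrite nbE /codom /image_mem -map_comp; apply: eq_map => i /=.
by rewrite ffunE IH.
Qed.

End FullInformation.

(** * Choosing a neighbour by port order *)

Section Choice.
Variable N : network.

(** The choice is recorded as an identifier because [local] needs a type that does not depend on the
    network. *)
Definition first (P : pred N) (v : N) : option nat :=
  ohead [seq ident u | u <- nb v & P u].

Variant first_spec (P : pred N) (v : N) : option nat -> Prop :=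
| FirstSome u of adj v u & P u : first_spec P v (Some (ident u))
| FirstNone of (forall u, adj v u -> ~~ P u) : first_spec P v None.

Lemma firstP P v : first_spec P v (first P v).
Proof.
rewrite /first; case E: [seq u <- nb v | P u] => [|u s] /=.
  apply: FirstNone => u vu; apply/negP => Pu.
  have: u \in [seq u <- nb v | P u] by rewrite mem_filter Pu mem_nb.
  by rewrite E.
have: u \in [seq u <- nb v | P u] by rewrite E mem_head.
by rewrite mem_filter mem_nb => /andP[Pu vu]; apply: FirstSome.
Qed.

End Choice.

Lemma local_first X Y (Q : X -> Y -> bool) f g :
  local f -> local g ->
  local (fun N v => first (fun u => Q (f N v) (g N u)) v).
Proof.
move=> lf lg.
have lp : local (fun N u => (ident u, g N u)) by apply: (local_app2 _ local_ident lg).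
pose F x (l : seq (nat * Y)) := ohead [seq q.1 | q <- l & Q x q.2].
by apply: eq_local (local_nb2 F lf lp) => N v; rewrite /F filter_map -map_comp.
Qed.

Lemma count_lt (T : eqType) (a b : pred T) (x : T) s :
  (forall y, a y -> b y) -> x \in s -> ~~ a x -> b x -> count a s < count b s.
Proof.
move=> ab + nax bx; elim: s => [//|y s IH] /=.
rewrite inE => /predU1P[<-|/IH lt].
  by rewrite (negbTE nax) bx ltnS sub_count.
by have := ab y; case: (a y) => [/(_ isT) ->|_] //; rewrite ?ltn_add2l // ltn_addl.
Qed.

(** * Greedy matching of out-copies to in-copies *)

Section Greedy.
Variable N : network.
Implicit Types (i : N -> option nat) (u v w : N).

(* [i v = Some (ident u)] means that the out-copy of [u] is matched to the
   in-copy of [v]. *)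
Definition valid i :=
  (forall v a, i v = Some a -> exists2 u, adj v u & a = ident u) /\
  (forall u v w, i v = Some (ident u) -> i w = Some (ident u) -> v = w).

Definition out i u := Some (ident u) \in [seq i v | v <- nb u].

(** The nodes whose out-copies, respectively in-copies, may receive new links. *)
Variables fo fi : pred N.

Definition propose i v :=
  if fo v && ~~ out i v then first (fun u => fi u && ~~ isSome (i u)) v else None.

Definition accept i v :=
  if i v is Some a then Some a else
  first (fun u => propose i u == Some (ident v)) v.

Definition greedy i := iter 3 accept i.

Lemma outP i u : valid i -> reflect (exists v, i v = Some (ident u)) (out i u).
Proof.
move=> [vi _]; apply: (iffP mapP) => [[v _ iv]|[v iv]]; first by exists v.
exists v => //; rewrite mem_nb adj_sym; by have [w aw /ident_inj ->] := vi _ _ iv.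
Qed.

Lemma valid_adj i u v : valid i -> i v = Some (ident u) -> adj v u.
Proof. by move=> [vi _] /vi[w aw /ident_inj ->]. Qed.

Lemma accept_old i v : i v -> accept i v = i v.
Proof. by rewrite /accept; case: (i v). Qed.

Lemma propose_Some i u a : propose i u = Some a ->
  [/\ fo u, ~~ out i u & exists v, [/\ adj u v, fi v, i v = None & a = ident v]].
Proof.
rewrite /propose; case: ifP => // /andP[fou ou].
case: firstP => // v uv /andP[fiv iv] [<-]; split=> //; exists v; split=> //.
by case: (i v) iv.
Qed.

Variant accept_spec i v : option nat -> Prop :=
| AcceptOld a of i v = Some a : accept_spec i v (Some a)
| AcceptNew u of i v = None & adj v u & propose i u = Some (ident v) :
    accept_spec i v (Some (ident u))
| AcceptNone of i v = None & (forall u, adj v u -> propose i u != Some (ident v)) :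
    accept_spec i v None.

Lemma acceptP i v : accept_spec i v (accept i v).
Proof.
rewrite /accept; case E: (i v) => [a|]; first by constructor.
by case: firstP => [u vu /eqP pu|np]; constructor.
Qed.

(** A new link cannot share its out-copy with an old one, since only free out-copies propose, nor
    with another new one, since a node makes one proposal per round. *)
Lemma valid_accept i : valid i -> valid (accept i).
Proof.
move=> vi; split=> [v a|u v w].
  case: acceptP => // [b iv [<-]|u _ vu _ [<-]]; last by exists u.
  by have [vi1 _] := vi; apply: vi1.
have [_ vi2] := vi.
have noold x y : i x = Some (ident y) -> propose i y = None.
  move=> ix; rewrite /propose; suff -> : out i y by rewrite andbF.
  by apply/outP => //; exists x.
case: acceptP => // [a iv [ea]|u' iv vu' pu [/ident_inj ea]];
  case: acceptP => // [b iw [eb]|w' iw wu' pw [/ident_inj eb]]; subst.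
- exact: vi2 iv iw.
- by rewrite (noold _ _ iv) in pw.
- by rewrite (noold _ _ iw) in pu.
- by move: pw; rewrite pu => -[/ident_inj].
Qed.

Definition extends i j :=
  (forall v, i v -> j v = i v) /\
  (forall u v, j v = Some (ident u) -> i v = None ->
     [/\ fo u, fi v & ~~ out i u]).

Lemma sub_out i j u : (forall v, i v -> j v = i v) -> out i u -> out j u.
Proof.
move=> ij /mapP[v uv iv]; apply/mapP; exists v => //.
by rewrite ij // -iv.
Qed.

Lemma iter_accept i n : valid i ->
  valid (iter n accept i) /\ extends i (iter n accept i).
Proof.
move=> vi; elim: n => [|n [vj [ij1 ij2]]] /=.
  by split=> //; split=> // u v ->.
split; first exact: valid_accept.
split=> [v iv|u v]; first by rewrite accept_old ij1.
set j := iter n accept i in vj ij1 ij2 *.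
case: acceptP => // [a jv [ea]|w jv vw pw [/ident_inj ew]] iv; subst.
  exact: ij2 jv iv.
have [fou ou [x [ux fix_ jx /ident_inj ex]]] := propose_Some pw; subst x.
by split=> //; apply: contra ou; apply: sub_out.
Qed.

Lemma valid_greedy i : valid i -> valid (greedy i).
Proof. by case/(iter_accept 3). Qed.

Lemma greedy_extends i : valid i -> extends i (greedy i).
Proof. by case/(iter_accept 3). Qed.

Definition free_nb i u := count (fun v => fi v && ~~ isSome (i v)) (nb u).

(* A proposal is always answered by the acceptance of some proposal, so a node
   that remains unmatched sees the number of its available neighbours drop in
   each of the three rounds. *)
Lemma free_nb_iter i n u : valid i -> fo u -> ~~ out (iter n accept i) u ->
  free_nb (iter n accept i) u <= 3 - n.
Proof.
move=> vi fou; elim: n => [|n IH] ou.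
  by rewrite subn0 (leq_trans (count_size _ _)) ?size_nb.
rewrite /= in ou *; set j := iter n accept i in ou IH *.
have oj : ~~ out j u by apply: contra ou; apply: sub_out => v; apply: accept_old.
have le v : fi v && ~~ isSome (accept j v) -> fi v && ~~ isSome (j v).
  by case/andP=> -> /=; apply: contra => jv; rewrite accept_old.
have [-> //|nz] := eqVneq (free_nb (accept j) u) 0.
have lt : free_nb (accept j) u < free_nb j u.
  have: propose j u = first (fun v => fi v && ~~ isSome (j v)) u.
    by rewrite /propose fou oj.
  case: firstP => [v uv Pv pu|no _]; last first.
    case/negP: nz; rewrite -leqn0 leqNgt -has_count; apply/hasPn => v.
    by rewrite mem_nb => /no; apply: contra; apply: le.
  have av : isSome (accept j v).
    case: acceptP => // _ /(_ u); rewrite adj_sym uv => /(_ isT).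
    by rewrite pu eqxx.
  have vn : v \in nb u by rewrite mem_nb.
  by apply: (count_lt (x := v)) => //; rewrite av andbF.
have := IH oj; lia.
Qed.

Lemma greedy_maximal i u v : valid i -> adj u v -> fo u -> fi v ->
  out (greedy i) u || isSome (greedy i v).
Proof.
move=> vi uv fou fiv; case ou: (out _ _) => //=.
have := free_nb_iter vi fou (negbT ou).
rewrite leqn0 -leqn0 leqNgt -has_count => /hasPn/(_ v).
by rewrite mem_nb uv fiv /= negbK => /(_ isT).
Qed.

End Greedy.

Lemma count_unique (T : eqType) (P : pred T) s :
  uniq s -> (forall x y, P x -> P y -> x = y) -> count P s = has P s.
Proof.
move=> + uP; elim: s => //= x s IH /andP[xs us].
rewrite {}IH //; case Px: (P x) => //=; case: hasP => // -[y ys Py].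
by rewrite (uP x y) // ys in xs.
Qed.

(** * The phases of the construction *)

Section HalfMatching.
Variable N : network.
Implicit Types u v w : N.

Definition m1 : N -> option nat := greedy predT predT (fun=> None).

Definition half v := isSome (m1 v) (+) out m1 v.

(* [hdeg], [hload], [mload] and [load2] count in units of 1/2. *)
Definition hdeg v := if half v then count half (nb v) else 0.

(* Only meaningful for adjacent [u] and [v]. *)
Definition isolated u v :=
  [&& half u, half v, hdeg u == 1 & hdeg v == 1].

Definition hload v := hdeg v + count (isolated v) (nb v).

(** Links are stored at their in-copies, so the link at [v] must go when either [v] or the owner of
    the matched out-copy is saturated. *)
Definition m2 v : option nat :=
  if (hload v == 2) ||
     has (fun u => (hload u == 2) && (m1 v == Some (ident u))) (nb v)
  then None else m1 v.

Definition fi v := hload v == 0.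
(* A node with [hload v = 1] has room for a single link only if it lost the one
   it had in [m1]; its out-copy then stands for that room. *)
Definition fo v :=
  (hload v == 0) || [&& hload v == 1, ~~ isSome (m2 v) & ~~ out m2 v].

Definition m3 : N -> option nat := greedy fo fi m2.

Definition mload v := isSome (m3 v) + out m3 v.

Definition unsat v := mload v + hload v < 2.

Definition pick v := if unsat v then first unsat v else None.

Definition mutual u v := (pick u == Some (ident v)) && (pick v == Some (ident u)).

(** The value of an edge in units of 1/2, with one summand for each source of load. *)
Definition weight u v : nat :=
  (m3 u == Some (ident v)) + (m3 v == Some (ident u)) +
  (half u && half v) + isolated u v + mutual u v.

(** * Loads after the first three phases *)

Lemma valid_m1 : valid m1.
Proof. by apply: valid_greedy; split. Qed.

Lemma m1_maximal u v : adj u v -> out m1 u || isSome (m1 v).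
Proof. by move=> uv; apply: greedy_maximal => //; split. Qed.

(** If both were half, the out-copy of [v] and the in-copy of [u] would be free, against
    maximality. *)
Lemma m1_half u v : m1 v = Some (ident u) -> ~~ (half u && half v).
Proof.
move=> mv; have vu := valid_adj valid_m1 mv.
have ou : out m1 u by apply/(outP _ valid_m1); exists v.
have := m1_maximal vu; rewrite /half ou mv /=.
by case: (out m1 v); case: (m1 u).
Qed.

Lemma half_partner v : half v -> exists2 w, adj v w & ~~ half w.
Proof.
move=> hv; move: (hv); rewrite /half.
case E: (m1 v) => [a|] /=.
  have [w vw ea] := valid_m1.1 _ _ E; subst a => _.
  by exists w => //; have := m1_half E; rewrite hv andbT.
case/(outP _ valid_m1) => w mw; exists w.
  by rewrite adj_sym; apply: valid_adj valid_m1 mw.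
by have := m1_half mw; rewrite hv.
Qed.

Lemma hdeg_le2 v : hdeg v <= 2.
Proof.
rewrite /hdeg; case: ifP => // /half_partner[w vw hw].
have := size_nb v; rewrite -(count_predC half) => le3.
have : 0 < count (predC half) (nb v).
  by rewrite -has_count; apply/hasP; exists w; rewrite ?mem_nb.
lia.
Qed.

Lemma hload_half v : 0 < hload v -> half v.
Proof.
rewrite /hload /hdeg; case: ifP => // /negbT hv.
rewrite add0n (@eq_count _ _ pred0) ?count_pred0 // => u.
by rewrite /isolated (negbTE hv).
Qed.

(** Isolated edges add to [hdeg v] only when it is 1, and then only the edge to the single half
    neighbour does. *)
Lemma hload_le2 v : hload v <= 2.
Proof.
rewrite /hload; have := hdeg_le2 v.
have [h1|h1] := eqVneq (hdeg v) 1; last first.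
  rewrite (@eq_count _ (isolated v) pred0) ?count_pred0 ?addn0 // => u.
  by rewrite /isolated (negbTE h1) /= !andbF.
move=> _; move: (h1); rewrite /hdeg; case: ifP => // _ cE.
rewrite cE ltnS -cE; apply: sub_count => u; by case/and4P.
Qed.

Lemma half_adj u v : half u -> half v -> adj u v -> 0 < hload u.
Proof.
move=> hu hv uv; rewrite /hload /hdeg hu ltn_addr // -has_count.
by apply/hasP; exists v => //; rewrite mem_nb.
Qed.

(** The one half neighbour [b] of [u] has [u] as a half neighbour; as the edge is not isolated, [b]
    has another one. *)
Lemma hload1_nb u : hload u = 1 -> exists b, [/\ adj u b, half b & hload b = 2].
Proof.
move=> h1; have hu : half u by apply: hload_half; rewrite h1.
move: (h1); rewrite /hload.
have hd0 : 0 < hdeg u.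
  rewrite lt0n; apply: contra_eq_neq h1 => h0; rewrite /hload h0 add0n.
  rewrite (@eq_count _ _ pred0) ?count_pred0 // => b.
  by rewrite /isolated h0 /= !andbF.
move=> h1'; have hd1 : hdeg u = 1 by lia.
have c0 : count (isolated u) (nb u) = 0 by lia.
move: hd0; rewrite /hdeg hu -has_count => /hasP[b bn hb].
exists b; split=> //; first by rewrite -mem_nb.
have nib : ~~ isolated u b.
  apply/negP=> ib; move/eqP: c0; apply/negP.
  by rewrite -lt0n -has_count; apply/hasP; exists b.
have nb1 : hdeg b != 1 by move: nib; rewrite /isolated hu hb hd1.
have nb0 : 0 < hdeg b.
  rewrite /hdeg hb -has_count; apply/hasP; exists u => //.
  by rewrite mem_nb adj_sym -mem_nb.
have hd : 1 < hdeg b by rewrite ltn_neqAle eq_sym nb1.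
by apply/eqP; rewrite eqn_leq hload_le2 (leq_trans hd (leq_addr _ _)).
Qed.

Lemma m2_Some v a : m2 v = Some a ->
  [/\ m1 v = Some a, hload v < 2 & forall u, a = ident u -> hload u < 2].
Proof.
rewrite /m2; case: ifP => // /norP[h2 /hasPn no] m1v; split=> //.
  by rewrite ltn_neqAle h2 hload_le2.
move=> u ea; rewrite ltn_neqAle hload_le2 andbT; subst a.
have un : u \in nb v by rewrite mem_nb; apply: valid_adj valid_m1 m1v.
by have := no _ un; rewrite m1v eqxx andbT.
Qed.

Lemma valid_m2 : valid m2.
Proof.
split=> [v a /m2_Some[mv _ _]|u v w /m2_Some[mv _ _] /m2_Some[mw _ _]].
  exact: valid_m1.1 mv.
exact: valid_m1.2 mv mw.
Qed.

Lemma valid_m3 : valid m3.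
Proof. by apply/valid_greedy/valid_m2. Qed.

Lemma m3_ext : extends fo fi m2 m3.
Proof. by apply/greedy_extends/valid_m2. Qed.

Lemma m3_hload u v : m3 v = Some (ident u) -> hload u < 2 /\ hload v < 2.
Proof.
move=> mv; have [old new] := m3_ext; case E: (m2 v) => [a|].
  have m2v : m2 v = Some (ident u) by rewrite -mv old // E.
  by have [_ ? hu] := m2_Some m2v; split=> //; apply: hu.
have [fou fiv _] := new _ _ mv E.
by move: fou fiv; rewrite /fo /fi; case: (hload u) (hload v) => [|[|?]] [|[|?]].
Qed.

Lemma out_m2 u : out m2 u -> out m1 u.
Proof.
case/(outP _ valid_m2) => v /m2_Some[mv _ _].
by apply/(outP _ valid_m1); exists v.
Qed.

Lemma hload2_mload v : hload v = 2 -> mload v = 0.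
Proof.
rewrite /mload => h2; case E: (m3 v) => [a|] /=.
  have [u _ ea] := valid_m3.1 _ _ E; subst a.
  by have [_] := m3_hload E; rewrite h2.
case: (outP _ valid_m3) => // -[w /m3_hload[]]; by rewrite h2.
Qed.

(** As [fi v] fails, a link at the in-copy stems from [m2]. Then the out-copy is free in [m2]
    because [v] is half, and [fo v] fails, so it stays free. *)
Lemma hload1_mload v : hload v = 1 -> mload v <= 1.
Proof.
move=> h1; have hv : half v by apply: hload_half; rewrite h1.
have [old new] := m3_ext; rewrite /mload.
case E: (m3 v) => [a|] /=; last by case: (out _ _).
case: (outP _ valid_m3) => // -[w mw].
have m2v : m2 v.
  have [u _ ea] := valid_m3.1 _ _ E; subst a.
  case F: (m2 v) => //; have [_] := new _ _ E F.
  by rewrite /fi h1.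
have nout : ~~ out m2 v.
  apply/negP=> /out_m2 o; case F: (m2 v) m2v => [b|//] _.
  by have [m1v _ _] := m2_Some F; move: hv; rewrite /half o m1v.
have m2w : m2 w = None.
  case F: (m2 w) => [b|//]; case/(outP _ valid_m2): nout.
  by exists w; rewrite -mw old // F.
by have [] := new _ _ mw m2w; rewrite /fo h1 m2v.
Qed.

Lemma load_le2 v : mload v + hload v <= 2.
Proof.
have := hload_le2 v; case E: (hload v) => [|[|[|//]]] _.
- by rewrite addn0 /mload; case: (m3 v); case: (out _ _).
- by rewrite addn1 ltnS hload1_mload.
by rewrite hload2_mload.
Qed.

(** * Structure of the unsaturated nodes *)

Definition lost v :=
  has (fun a => (hload a == 2) &&
         ((m1 v == Some (ident a)) || (m1 a == Some (ident v)))) (nb v).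

Lemma not_lost v : hload v < 2 -> ~~ lost v ->
  (m1 v -> m3 v) /\ (out m1 v -> out m3 v).
Proof.
move=> h2 /hasPn nl; have [old _] := m3_ext; split.
  case E: (m1 v) => [a|//] _; suff m2v : m2 v by rewrite old.
  rewrite /m2 ltn_eqF //=; case: hasP => [[u un /andP[hu mu]]|_]; last by rewrite E.
  by have := nl _ un; rewrite hu mu.
case/(outP _ valid_m1) => w mw.
have wn : w \in nb v by rewrite mem_nb adj_sym; apply: valid_adj valid_m1 mw.
have := nl _ wn; rewrite mw eqxx orbT andbT => hw.
apply: (sub_out old); apply/(outP _ valid_m2); exists w.
rewrite /m2 (negbTE hw) /=; case: hasP => [[u _ /andP[/eqP hu]]|//].
by rewrite mw => /eqP[/ident_inj e]; rewrite -e in hu; rewrite hu in h2.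
Qed.

Lemma unsat_hload v : unsat v -> hload v < 2.
Proof. by rewrite /unsat; lia. Qed.

(** If both kept all [m1] links, a positive [hload] would saturate, so it is 0 at both. Maximality
    of [m1] on the two links of the edge then either saturates an end or makes both ends half, which
    forces a positive [hload]. *)
Lemma unsat_lost u v : adj u v -> unsat u -> unsat v -> lost u || lost v.
Proof.
move=> uv su sv; apply/negPn/negP => /norP[lu lv].
have vu : adj v u by rewrite adj_sym.
have [iu ou] := not_lost (unsat_hload su) lu.
have [iv ov] := not_lost (unsat_hload sv) lv.
have h0 w : unsat w -> (m1 w -> m3 w) -> (out m1 w -> out m3 w) -> hload w = 0.
  move=> sw iw ow; case E: (hload w) => [//|n].
  have hw : half w by apply: hload_half; rewrite E.
  have : m3 w || out m3 w.
    move: hw iw ow; rewrite /half; case: (m1 w) => [?|]; case: (out m1 w) => //= _.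
      by move=> /(_ isT)->.
    by move=> _ /(_ isT)->; rewrite orbT.
  move: sw; rewrite /unsat E /mload.
  by case: (m3 w); case: (out m3 w) => //=; rewrite ?addnS.
have hu0 := h0 _ su iu ou; have hv0 := h0 _ sv iv ov.
have nh : ~~ (half u && half v).
  by apply/negP=> /andP[hu hv]; have := half_adj hu hv uv; rewrite hu0.
move: su sv iu ou iv ov nh (m1_maximal uv) (m1_maximal vu).
rewrite /unsat /mload hu0 hv0 /half.
case: (m1 u); case: (out m1 u); case: (m1 v); case: (out m1 v) => //=;
case: (m3 u); case: (out m3 u); case: (m3 v); case: (out m3 v) => //= *; intuition.
Qed.

Lemma m3_maximal u v : adj u v -> fo u -> fi v -> out m3 u || isSome (m3 v).
Proof. by move=> uv fou fiv; apply: greedy_maximal => //; apply: valid_m2. Qed.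

Lemma unsat_fo v : unsat v -> ~~ isSome (m3 v) -> ~~ out m3 v -> fo v.
Proof.
move=> sv iv ov; have [old new] := m3_ext; rewrite /fo.
have := unsat_hload sv; case: (hload v) => [//|[|//]] _ /=.
apply/andP; split; first by apply: contra iv => i2; rewrite old.
by apply: contra ov; apply: sub_out.
Qed.

(** Were the load of [u] zero, both its copies would be free and eligible, so each eligible copy of
    [v] would be matched, saturating [v]. *)
Lemma unsat0_nb u v : adj u v -> unsat u -> unsat v ->
  mload u + hload u = 1.
Proof.
move=> uv su sv; have vu : adj v u by rewrite adj_sym.
have [//|] := eqVneq (mload u + hload u) 1 => ne.
have: mload u + hload u = 0 by move: su ne; rewrite /unsat; lia.
move/eqP; rewrite addn_eq0 /mload addn_eq0 => /andP[/andP[iu ou] hu].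
have {iu}iu : ~~ isSome (m3 u) by case: (m3 u) iu.
have {ou}ou : ~~ out m3 u by case: (out m3 u) ou.
have := m3_maximal uv; have := m3_maximal vu.
rewrite (unsat_fo su iu ou) /fi hu (negbTE iu) (negbTE ou) orbF /=.
case E: (hload v == 0).
  rewrite /fo E /= => /(_ isT isT) ov /(_ isT isT) iv.
  by move: sv; rewrite /unsat /mload iv ov.
have ov : ~~ out m3 v -> fo v.
  move=> ov; apply: unsat_fo => //.
  apply/negP => iv; move: sv E; rewrite /unsat /mload iv.
  by case: (hload v) => // n; rewrite !addnS.
case O: (out m3 v) => /=; last by move=> /(_ (ov (negbT O)) isT).
move: sv E; rewrite /unsat /mload O.
by case: (hload v) => // n; rewrite !addnS.
Qed.

Lemma four_nb u a b v w : uniq [:: a; b; v; w] -> adj u a -> adj u b ->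
  adj u v -> adj u w -> False.
Proof.
move=> un ua ub uv uw.
have: size [:: a; b; v; w] <= size (nb u).
  apply: uniq_leq_size => // x; rewrite mem_nb !inE.
  by case/or4P => /eqP->.
by move/leq_trans/(_ (size_nb u)).
Qed.

(* The edge of [u] to the node that dropped it and the one edge that carries
   [u]'s remaining load both lead to saturated nodes. *)
Lemma lost_unique_nb u v w : lost u -> unsat u -> adj u v -> unsat v ->
  adj u w -> unsat w -> v = w.
Proof.
move=> /hasP[a]; rewrite mem_nb => ua /andP[/eqP ha ma] su uv sv uw sw.
have nsat x : hload x = 2 -> ~~ unsat x by rewrite /unsat => ->; rewrite -leqNgt leq_addl.
(* Otherwise [a], [b], [v], [w] would be four distinct neighbours of [u]. *)
suff [b [ub sb ab]] : exists b, [/\ adj u b, ~~ unsat b & a != b].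
  apply/eqP/negPn/negP => vw; apply: (@four_nb u a b v w) => //=.
  have ne x y : ~~ unsat x -> unsat y -> x != y.
    by move=> /[swap] ?; apply: contraNneq => ->.
  by rewrite !inE !negb_or ab vw !ne // nsat.
have := unsat0_nb uv su sv; case E: (hload u) => [|[|n]]; last first.
- by rewrite !addnS.
(* Here [a] differs from [b] since no [m1] link joins two half nodes. *)
- move=> _; have [b [ub hb h2]] := hload1_nb E; exists b; split=> //; first exact: nsat.
  have hu : half u by apply: hload_half; rewrite E.
  apply: contraTneq ma => eab; subst b; apply/norP; split; apply/eqP => /m1_half.
    by rewrite hu hb.
  by rewrite hu hb.
have fou : fo u by rewrite /fo E.
have fiu : fi u by rewrite /fi E.
rewrite addn0 => m1'.
have ne b : hload b < 2 -> a != b by apply: contraTneq => <-; rewrite ha.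
(* Now [b] is the [m3] partner of [u]. The other copy of [u] is free and eligible, so maximality
   saturates [b] if its [hload] is 0; otherwise the link and [hload] do. *)
move: m1'; rewrite /mload; case F: (m3 u) => [c|] /=.
  have [b ub ec] := valid_m3.1 _ _ F; subst c => ou.
  have [hb _] := m3_hload F.
  exists b; split=> //; last exact: ne.
  have ob : out m3 b by apply/(outP _ valid_m3); exists u.
  apply/negP => sb; have := m3_maximal ub fou.
  move: sb; rewrite /unsat /mload /fi ob; case: (out m3 u) ou => //= _.
  case: (m3 b) => [?|] //=.
  by case: (hload b) => // _ /(_ isT).
case O: (out m3 u) => // _; have /(outP _ valid_m3)[b mb] := O.
have [_ hb] := m3_hload mb.
have bu := valid_adj valid_m3 mb.
exists b; split; [by rewrite adj_sym| |exact: ne].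
apply/negP => sb; have := m3_maximal bu.
rewrite /fo F orbF fiu; move: sb; rewrite /unsat /mload mb.
case: (hload b) => [|n]; last by rewrite addnS.
by case: (out m3 b) => // _ /(_ isT isT).
Qed.

(** * Mutual picks and final loads *)

Lemma mutualC u v : mutual u v = mutual v u.
Proof. by rewrite /mutual andbC. Qed.

Lemma pick_unsat u v : pick u = Some (ident v) -> [/\ unsat u, adj u v & unsat v].
Proof.
by rewrite /pick; case: ifP => // su; case: firstP => // w uw sw [/ident_inj <-].
Qed.

Lemma lost_pick u v : lost u -> unsat u -> adj u v -> unsat v ->
  pick u = Some (ident v).
Proof.
move=> lu su uv sv; rewrite /pick su; case: firstP => [w uw sw|/(_ v uv)].
  by rewrite (lost_unique_nb lu su uv sv uw sw).
by rewrite sv.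
Qed.

Lemma mutual_cover u v : adj u v -> unsat u -> unsat v ->
  has (mutual u) (nb u) || has (mutual v) (nb v).
Proof.
(* If [u] has lost a link, it must pick [v]. Whatever [w] is picked by [v], the pick is mutual:
   either [v] is lost and [w] is [u], or [w] is lost and has only [v] to pick. *)
wlog lu : u v / lost u.
  move=> H uv su sv; case/orP: (unsat_lost uv su sv) => l; first exact: H.
  by rewrite orbC H // adj_sym.
move=> uv su sv; have vu : adj v u by rewrite adj_sym.
have pu := lost_pick lu su uv sv.
have [w pv] : exists w, pick v = Some (ident w).
  rewrite /pick sv; case: firstP => [w _ _|/(_ u vu)]; first by exists w.
  by rewrite su.
have [_ vw sw] := pick_unsat pv.
apply/orP; right; apply/hasP; exists w; first by rewrite mem_nb.
rewrite /mutual pv eqxx /=.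
have [lv|nlv] := boolP (lost v).
  by rewrite (lost_unique_nb lv sv vw sw vu su) pu.
have := unsat_lost vw sv sw; rewrite (negbTE nlv) /= => lw.
by rewrite (@lost_pick w v) // adj_sym.
Qed.

Definition load2 v := \sum_(u <- nb v) weight v u.

Lemma load2E v : load2 v = mload v + hload v + has (mutual v) (nb v).
Proof.
rewrite /load2 /weight 4!big_split /=.
have sumE (P : pred N) : \sum_(u <- nb v) P u = count P (nb v).
  by rewrite -sum1_count [RHS]big_mkcond.
rewrite !sumE (@count_unique _ (fun u => m3 v == _)) ?nb_uniq //; last first.
  by move=> x y /eqP-> /eqP[/ident_inj].
rewrite (@count_unique _ (mutual v)) ?nb_uniq //; last first.
  by move=> x y /andP[/eqP px _] /andP[/eqP]; rewrite px => -[/ident_inj].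
rewrite (@count_unique _ (fun u => m3 u == _)) ?nb_uniq //; last first.
  by move=> x y /eqP mx /eqP my; apply: valid_m3.2 mx my.
rewrite /mload /hload !addnA; congr (_ + _ + _ + _ + _).
- congr nat_of_bool; case E: (m3 v) => [a|] /=; last by apply/hasP => -[].
  have [u vu ->] := valid_m3.1 _ _ E.
  by apply/hasP; exists u; rewrite ?mem_nb ?eqxx.
- congr nat_of_bool; rewrite /out; apply/hasP/mapP => [[x xn /eqP]|[x xn]] mx;
    by exists x => //; apply/eqP.
rewrite /hdeg; case: (half v) => //=; apply: count_pred0.
Qed.

Lemma load2_le2 v : load2 v <= 2.
Proof.
rewrite load2E; have le2 := load_le2 v.
case: hasP => [[u _ /andP[/eqP/pick_unsat[su _ _] _]]|_]; last by rewrite addn0.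
by rewrite addn1; apply: su.
Qed.

Lemma load2_cover u v : adj u v -> load2 u = 2 \/ load2 v = 2.
Proof.
move=> uv; have := load2_le2 u; have := load2_le2 v; rewrite !load2E.
have vu : adj v u by rewrite adj_sym.
case su: (unsat u); last by move: su; rewrite /unsat; lia.
case sv: (unsat v); last by move: sv; rewrite /unsat; lia.
rewrite (unsat0_nb uv su sv) (unsat0_nb vu sv su).
by case/orP: (mutual_cover uv su sv) => ->; [left|right].
Qed.

Lemma weightC u v : weight u v = weight v u.
Proof.
rewrite /weight /isolated mutualC [half u && half v]andbC; congr (_ + _ + _ + _).
  by rewrite addnC.
by case: (half u); case: (half v) => //=; rewrite andbC.
Qed.

End HalfMatching.

(** * Locality of every phase *)

Lemma local_out i : local i -> local (fun N v => @out N (i N) v).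
Proof. exact: (local_nb2 (fun a l => Some a \in l) local_ident). Qed.

Lemma local_propose fo fi i : local fo -> local fi -> local i ->
  local (fun N v => @propose N (fo N) (fi N) (i N) v).
Proof.
move=> lfo lfi li.
have lf : local (fun N v => first (fun u => fi N u && ~~ isSome (i N u)) v).
  apply: (local_first (fun _ y => y) (local_const tt)).
  exact: (local_app2 (fun b a => b && ~~ isSome a) lfi li).
apply: (local_app2 (fun b a => if b then a else None)) lf.
exact: (local_app2 (fun b o => b && ~~ o) lfo (local_out li)).
Qed.

Lemma local_accept fo fi i : local fo -> local fi -> local i ->
  local (fun N v => @accept N (fo N) (fi N) (i N) v).
Proof.
move=> lfo lfi li.
apply: (local_app2 (fun a b => if a is Some c then Some c else b) li).
exact: (local_first (fun a b => b == Some a) local_ident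
                    (local_propose lfo lfi li)).
Qed.

Lemma local_greedy fo fi i : local fo -> local fi -> local i ->
  local (fun N v => @greedy N (fo N) (fi N) (i N) v).
Proof.
by move=> lfo lfi li; do 3!apply: (local_accept lfo lfi).
Qed.

Lemma local_m1 : local m1.
Proof. by apply: local_greedy; apply: local_const. Qed.

Lemma local_half : local half.
Proof.
exact: (local_app2 (fun a o => isSome a (+) o) local_m1 (local_out local_m1)).
Qed.

Lemma local_hdeg : local hdeg.
Proof.
apply: eq_local (local_nb2 (fun h l => if h then count id l else 0)
  local_half local_half) => N v.
by rewrite count_map.
Qed.

Lemma local_hload : local hload.
Proof.
have ld := local_app2 pair local_half local_hdeg.
pose Q (x y : bool * nat) := [&& x.1, y.1, x.2 == 1 & y.2 == 1].
apply: eq_local (local_nb2 (fun x l => x.2 + count (Q x) l) ld ld) => N v.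
by rewrite count_map.
Qed.

Lemma local_m2 : local m2.
Proof.
have l := local_app2 pair local_m1 local_hload.
have l' := local_app2 pair local_ident local_hload.
pose F (x : option nat * nat) (s : seq (nat * nat)) :=
  if (x.2 == 2) || has (fun y => (y.2 == 2) && (x.1 == Some y.1)) s
  then None else x.1.
by apply: eq_local (local_nb2 F l l') => N v; rewrite /F has_map.
Qed.

Lemma local_m3 : local m3.
Proof.
apply: local_greedy local_m2.
  apply: (local_app2 (fun n b => (n == 0) || (n == 1) && b) local_hload).
  exact: (local_app2 (fun a o => ~~ isSome a && ~~ o) local_m2
                     (local_out local_m2)).
exact: (local_app2 (fun n _ => n == 0) local_hload (local_const tt)).
Qed.

Lemma local_unsat : local unsat.
Proof.
have lm : local mload.
  exact: (local_app2 (fun a (o : bool) => isSome a + o) local_m3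
                     (local_out local_m3)).
exact: (local_app2 (fun m n => m + n < 2) lm local_hload).
Qed.

Lemma local_pick : local pick.
Proof.
apply: (local_app2 (fun b a => if b then a else None) local_unsat).
exact: (local_first (fun _ y => y) (local_const tt) local_unsat).
Qed.

Definition announce (N : network) (v : N) : seq rat :=
  [seq ((weight v u)%:R / 2)%R | u <- nb v].

Lemma local_announce : local announce.
Proof.
have l := local_app2 pair (local_app2 pair (local_app2 pair (local_app2 pair
  local_ident local_m3) local_half) local_hdeg) local_pick.
pose W (x y : nat * option nat * bool * nat * option nat) : nat :=
  let: (a, mx, hx, dx, px) := x in let: (b, my, hy, dy, py) := y in
  (mx == Some b) + (my == Some a) + (hx && hy) +
  [&& hx, hy, dx == 1 & dy == 1] + ((px == Some b) && (py == Some a)).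
apply: eq_local (local_nb2 (fun x s => [seq ((W x y)%:R / 2)%R | y <- s]) l l).
by move=> N v; rewrite -map_comp.
Qed.

(** * From weights to a rational edge labelling *)

Section EdgeLabelling.
Variable N : network.
Local Open Scope ring_scope.
Import GRing.Theory Num.Theory.

(** The orientation picked for [e] is immaterial because [weight] is symmetric on it, by
    [weightC]. *)
Definition edge_value (e : {set N}) : rat :=
  if [pick q : N * N | adj q.1 q.2 && (e == [set q.1; q.2])] is Some q
  then (weight q.1 q.2)%:R / 2 else 0.

Lemma edge_valueE (u v : N) :
  adj u v -> edge_value [set u; v] = (weight u v)%:R / 2.
Proof.
move=> uv; rewrite /edge_value; case: pickP => [[a b] /= /andP[ab /eqP e]|].
  have ua : u \in [set a; b] by rewrite -e set21.
  have va : v \in [set a; b] by rewrite -e set22.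
  have nuv : u != v by apply: contraTneq uv => ->; rewrite adj_irrefl.
  case/set2P: ua va nuv => ->; case/set2P => -> //; rewrite ?eqxx // => _.
  by rewrite weightC.
by move/(_ (u, v)); rewrite /= uv eqxx.
Qed.

Lemma load_edge_value (v : N) : load edge_value v = (load2 v)%:R / 2.
Proof.
rewrite /load (eq_bigl (mem [set [set v; u] | u in [set u | adj v u]])); last first.
  move=> e; rewrite !inE; apply/andP/imsetP => [[/imsetP[[a b]]]|[u]] /=.
    rewrite inE /= => ab -> /set2P[] ->; first by exists b; rewrite ?inE.
    by exists a; rewrite ?inE 1?adj_sym // setUC.
  rewrite inE => vu ->; split; last exact: set21.
  by apply/imsetP; exists (v, u); rewrite ?inE.
rewrite big_imset /=; last first.
  move=> a b; rewrite !inE => va vb e.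
  have : a \in [set v; b] by rewrite -e set22.
  by case/set2P => // av; rewrite av adj_irrefl in va.
rewrite /load2 natr_sum mulr_suml big_uniq ?nb_uniq //=.
rewrite (eq_bigl (fun u => u \in nb v)); last by move=> u; rewrite inE mem_nb.
by apply: eq_bigr => u; rewrite mem_nb => /edge_valueE.
Qed.

Lemma maximal_edge_value : maximal_half_integral_matching edge_value.
Proof.
(* A single weight is at most the whole load of an endpoint, which leaves only the values 0, 1/2 and
   1. *)
have wle (u v : N) : adj u v -> (weight u v <= 2)%N.
  move=> uv; apply: leq_trans (load2_le2 u).
  by rewrite /load2 (bigD1_seq v) ?nb_uniq ?mem_nb //= leq_addr.
have sat u : load2 u = 2 -> load edge_value u = 1.
  by rewrite load_edge_value => ->; rewrite divff.
have val e : e \in edges N ->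
    [\/ edge_value e = 0, edge_value e = 1 / 2 | edge_value e = 1].
  case/imsetP => -[u v]; rewrite inE /= => uv ->; rewrite edge_valueE //.
  case: (weight u v) (wle _ _ uv) => [|[|[|//]]] _.
  - by constructor 1; rewrite mul0r.
  - by constructor 2.
  by constructor 3; rewrite divff.
split; last exact: val.
split; last by move=> u v /load2_cover[] /sat; [left|right].
split=> [e /val[]-> //|v].
rewrite load_edge_value ler_pdivrMr // mul1r ler_nat; exact: load2_le2.
Qed.

End EdgeLabelling.

Theorem corollary1p3 (c : nat) (hc : 1 <= c) :
  exists (A : LOCAL_algorithm rat) (T : nat),
    forall (G : sgraph), max_deg_le G 3 ->
    forall (p : port_numbering G) (id : G -> nat), unique_ids c id ->
    exists2 x : {set G} -> rat,
      maximal_half_integral_matching x &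
      outputs_within A 3 p id T x.
Proof.
(* The radius of [announce] is the running time, fixed before the graph. *)
have [T [F FE]] := local_announce.
exists (full_information 0%R T F), T => G G3 p id [id_inj _].
have nbU v : uniq (codom (port p (v := v))).
  by rewrite map_inj_uniq ?enum_uniq //; apply: port_inj.
have nb3 v : size (codom (port p (v := v))) <= 3 by rewrite size_codom card_ord G3.
pose N := Network nbU (port_codom p) nb3 id_inj.
exists (@edge_value N); first exact: (maximal_edge_value N).
move=> v.
have -> : run (full_information 0%R T F) 3 p id T v = (T, @view N T v).
  exact: (@run_full_information _ 0%R T F 3 N p).
rewrite /= eqxx; eexists; first reflexivity.
move=> i; have vi : adj v (port p i) by rewrite -(port_codom p) codom_f.
rewrite ffunE -(FE N) (@edge_valueE N) // /announce /= /codom /image_mem -map_comp.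
by rewrite (nth_map i) ?size_enum_ord // nth_ord_enum.
Qed.
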